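(* For every integer $q\geq 4$, there exist a real constant $c>1$ and infinitely many balanced partite-$K_q$-divisible $q$-partite graphs $G$ with $\hat{\delta}(G)\geq \left(1-\frac{1}{c\cdot (q+1)}\right)\frac{v(G)}{q}$ such that $G$ has no $K_q$-decomposition and even no fractional $K_q$-decomposition.
   Context: Graphs are finite, simple and undirected, and ''infinitely many'' is understood up to isomorphism; $v(G)$ is the number of vertices of $G$. A graph $G$ is $q$-partite with $q$-partition $(V_1,\ldots,V_q)$ if $(V_1,\ldots,V_q)$ is a partition of $V(G)$ and each $V_i$ is an independent set in $G$; it is balanced if $|V_1|=\cdots=|V_q|$. For a vertex $x$ and a set $U\subseteq V(G)$, $d(x,U)$ denotes the number of neighbours of $x$ in $U$. For such a $G$ (with its $q$-partition), the partite minimum degree is $\hat{\delta}(G):=\min\{d(x,V_j): 1\leq j\leq q,\ x\in V(G)\setminus V_j\}$. A balanced $q$-partite graph $G$ with $q$-partition $(V_1,\ldots,V_q)$ is partite-$K_q$-divisible if for all integers $1\leq j_1<j_2\leq q$ and every $x\in V(G)\setminus (V_{j_1}\cup V_{j_2})$ we have $d(x,V_{j_1})=d(x,V_{j_2})$. A $K_q$-decomposition of $G$ is a partition of the edge set of $G$ into (edge sets of) edge-disjoint copies of $K_q$ in $G$. A fractional $K_q$-decomposition of $G$ is an assignment of non-negative real weights to the copies of $K_q$ in $G$ such that for every edge $e$ of $G$, the total weight of the copies of $K_q$ containing $e$ is exactly $1$. *)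

(* Defs.v *)
From mathcomp Require Import all_boot all_order all_algebra reals.

Set Implicit Arguments.
Unset Strict Implicit.
Unset Printing Implicit Defensive.

Import Order.TTheory GRing.Theory Num.Theory.

Record sgraph := SGraph {
  vertex :> finType;
  adj : rel vertex;
  adj_sym : symmetric adj;
  adj_irr : irreflexive adj
}.

Definition isomorphic (G H : sgraph) : Prop :=
  exists2 f : G -> H, bijective f & forall x y : G, adj (f x) (f y) = adj x y.

Definition infinitely_many_graphs (P : sgraph -> Prop) : Prop :=
  exists F : nat -> sgraph,
    (forall n, P (F n)) /\ (forall m n, m <> n -> ~ isomorphic (F m) (F n)).

Definition edges (G : sgraph) : {set {set G}} :=
  [set e : {set G} | [exists x, exists y, adj x y && (e == [set x; y])]].

Definition deg (G : sgraph) (x : G) (U : {set G}) : nat :=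
  #|[set y in U | adj x y]|.

Section Partite.

Variables (q : nat) (G : sgraph) (V : 'I_q -> {set G}).

Definition q_partition : Prop :=
  [/\ \bigcup_j V j = [set: G],
      (forall i j, i != j -> [disjoint V i & V j]) &
      (forall j x y, x \in V j -> y \in V j -> ~~ adj x y)].

Definition balanced : Prop := forall i j, #|V i| = #|V j|.

(* The initial value #|G| bounds every degree, so this is the exact minimum
   as soon as some pair (j, x) with x outside V j exists. *)
Definition partite_min_degree : nat :=
  \big[minn/#|G|]_(p : 'I_q * G | p.2 \notin V p.1) deg p.2 (V p.1).

Definition partite_divisible : Prop :=
  forall (j1 j2 : 'I_q) (x : G), (j1 < j2)%N -> x \notin V j1 :|: V j2 ->
    deg x (V j1) = deg x (V j2).

End Partite.

(* In a simple graph a copy of K_q is determined by its vertex set, so copies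
   are represented by the sets of q pairwise adjacent vertices. *)
Definition Kq_copy (q : nat) (G : sgraph) (K : {set G}) : bool :=
  (#|K| == q) && [forall x in K, forall y in K, (x != y) ==> adj x y].

Definition copy_edges (G : sgraph) (K : {set G}) : {set {set G}} :=
  [set e in edges G | e \subset K].

Definition has_Kq_decomposition (q : nat) (G : sgraph) : Prop :=
  exists P : {set {set {set G}}},
    partition P (edges G) /\
    (forall B, B \in P -> exists2 K : {set G}, Kq_copy q K & B = copy_edges K).

Definition has_fractional_Kq_decomposition
    (R : realType) (q : nat) (G : sgraph) : Prop :=
  exists w : {set G} -> R,
    (forall K, Kq_copy q K -> (0 <= w K)%R) /\
    (forall e, e \in edges G ->
       (\sum_(K : {set G} | Kq_copy q K && (e \in copy_edges K)) w K)%R = 1%R).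

(* Main.v *)
(** A fractional decomposition forces nonnegative total weight on the edges for
    every edge weighting that is nonnegative on each copy of K_q.  Split the
    vertices into A and B.  If a clique K has a vertices in A, then
    (a - 1)(a - 2) >= 0, and as |K| = q this quadratic in a is the sum over the
    ordered pairs of K of an edge weight depending only on membership in A.  In
    a q-partite graph where A-B pairs are complete while every vertex misses
    exactly D vertices of its own class in each other part, A and B having
    sizes s and n - s in each part, the total weight is a positive multiple of
      q(q-1)s(s-D) - 2qs(n-D) + 2n(n-D).
    At D = n/(q+1), minimising over s gives s = (3q-1)n/(2(q^2-1)) and the value
    is then a negative multiple of (q-3)^2; so for q >= 4 it stays negative for
    some D slightly below n/(q+1). *)
Require Import Defs.
From mathcomp Require Import all_boot all_order all_algebra reals.
From mathcomp Require Import zify ring lra.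

Set Implicit Arguments.
Unset Strict Implicit.
Unset Printing Implicit Defensive.

Import Order.TTheory GRing.Theory Num.Theory.
Local Open Scope ring_scope.

(** * Cliques, their edge sets and fractional decompositions *)

Lemma mem_edges (G : sgraph) (x y : G) : adj x y -> [set x; y] \in edges G.
Proof.
move=> xy; rewrite inE; apply/existsP; exists x; apply/existsP; exists y.
by rewrite xy eqxx.
Qed.

Lemma mem_copy_edges (G : sgraph) (K : {set G}) (x y : G) :
  adj x y -> ([set x; y] \in copy_edges K) = (x \in K) && (y \in K).
Proof.
by move=> xy; rewrite inE mem_edges // subUset !sub1set.
Qed.

Lemma Kq_copy_adj (q : nat) (G : sgraph) (K : {set G}) (x y : G) :
  Kq_copy q K -> x \in K -> y \in K -> adj x y = (x != y).
Proof.
case/andP=> _ /forall_inP cK xK yK; apply/idP/idP.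
  by apply: contraTneq => ->; rewrite adj_irr.
by move/forall_inP: (cK x xK) => /(_ y yK) /implyP.
Qed.

(** Makes [copy_edges] injective on copies: with at least two vertices, every vertex of a clique
    lies on one of its edges. *)
Lemma bigcup_copy_edges (q : nat) (G : sgraph) (K : {set G}) :
  (1 < q)%N -> Kq_copy q K -> \bigcup_(e in copy_edges K) e = K.
Proof.
move=> q_gt1 cK; apply/setP=> x; apply/bigcupP/idP => [[e]|xK].
  by rewrite inE => /andP[_ /subsetP eK] /eK.
have /eqP szK := proj1 (andP cK).
have [y] : exists y, y \in K :\ x.
  by apply/set0Pn; rewrite -card_gt0; move: szK; rewrite (cardsD1 x) xK; lia.
rewrite !inE => /andP[yx yK]; exists [set x; y]; last by rewrite !inE eqxx.
by rewrite mem_copy_edges ?xK // (Kq_copy_adj cK) // eq_sym.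
Qed.

(** Give weight 1 to the cliques whose edge set is a block and 0 to the others. Two such cliques
    through one edge have the same block, hence the same vertices. *)
Lemma fractional_of_decomposition (R : realType) (q : nat) (G : sgraph) :
  (1 < q)%N -> has_Kq_decomposition q G ->
  has_fractional_Kq_decomposition R q G.
Proof.
move=> q_gt1 [P [/and3P[/eqP covP trivP _] copyP]].
exists (fun K => (copy_edges K \in P)%:R); split=> [K _|e eG].
  by rewrite ler0n.
have : e \in cover P by rewrite covP.
case/bigcupP=> B BP eB; have [K cK BK] := copyP B BP; subst B.
rewrite (bigD1 K) /=; last by rewrite cK.
rewrite BP big1 ?addr0 // => L /andP[/andP[cL eL] LK].
case LP : (_ \in P) => //; case/eqP: LK.
rewrite -(bigcup_copy_edges q_gt1 cL) -(bigcup_copy_edges q_gt1 cK).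
by rewrite -(def_pblock trivP LP eL) -(def_pblock trivP BP eB).
Qed.

(* Weak LP duality. *)
Lemma fractional_dual (R : realType) (q : nat) (G : sgraph) (g : G -> G -> R) :
  has_fractional_Kq_decomposition R q G ->
  (forall K : {set G}, Kq_copy q K ->
     0 <= \sum_(x in K) \sum_(y in K | y != x) g x y) ->
  0 <= \sum_x \sum_(y | adj x y) g x y.
Proof.
case=> w [w_ge0 w_sum] g_ge0.
pose h (K : {set G}) x y := if [&& x \in K, y \in K & adj x y] then w K * g x y else 0.
have -> : \sum_x \sum_(y | adj x y) g x y =
    \sum_x \sum_y \sum_(K : {set G} | Kq_copy q K) h K x y.
  apply: eq_bigr => x _; rewrite big_mkcond; apply: eq_bigr => y _.
  case: ifP => xy; last first.
    by rewrite big1 // => K _; rewrite /h xy !andbF.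
  (* The factor 1 in front of [g x y] is expanded as the total weight of the copies through the
     edge; exchanging the sums then groups the terms by copy. *)
  rewrite -[LHS]mul1r -(w_sum _ (mem_edges xy)) mulr_suml big_mkcondr.
  by apply: eq_bigr => K _; rewrite /h xy mem_copy_edges // andbT.
under eq_bigr do rewrite exchange_big.
rewrite exchange_big; apply: sumr_ge0 => K cK.
have -> : \sum_x \sum_y h K x y =
    w K * \sum_(x in K) \sum_(y in K | y != x) g x y.
  rewrite mulr_sumr [RHS]big_mkcond; apply: eq_bigr => x _.
  case: ifP => xK; last by rewrite big1 // => y _; rewrite /h xK.
  rewrite mulr_sumr [RHS]big_mkcond; apply: eq_bigr => y _; rewrite /h xK /=.
  by case yK: (y \in K) => //=; rewrite (Kq_copy_adj cK) // eq_sym.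
by rewrite mulr_ge0 ?w_ge0 ?g_ge0.
Qed.

(** * The edge weighting attached to a vertex class *)

(* Scaled so that it sums to [q(q-1)(a-1)(a-2)] over the ordered pairs of a
   q-clique having [a] vertices in [A]. *)
Definition class_weight (R : realType) (q : nat) (T : finType) (A : {set T})
    (x y : T) : R :=
  q%:R * (q%:R - 1) * (x \in A)%:R * (y \in A)%:R - 2 * q%:R * (x \in A)%:R + 2.

Lemma sum_mem (R : realType) (T : finType) (P : pred T) (A : {set T}) :
  \sum_(x | P x) (x \in A)%:R = #|[set x in A | P x]|%:R :> R.
Proof.
rewrite -sumr_const [RHS](eq_bigl (fun x => P x && (x \in A))); last first.
  by move=> x; rewrite inE andbC.
by rewrite [RHS]big_mkcondr; apply: eq_bigr => x _; case: (x \in A).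
Qed.

Lemma sum_class_weight_row (R : realType) (q : nat) (T : finType)
    (A : {set T}) (x : T) (P : pred T) :
  \sum_(y | P y) class_weight R q A x y =
  q%:R * (q%:R - 1) * (x \in A)%:R * #|[set y in A | P y]|%:R
  + (2 - 2 * q%:R * (x \in A)%:R) * #|[set y | P y]|%:R.
Proof.
rewrite /class_weight; under eq_bigr do rewrite -addrA.
rewrite big_split /= -mulr_sumr sum_mem; congr (_ + _).
by rewrite sumr_const addrC cardsE -[LHS]mulr_natr.
Qed.

Lemma consecutive_product_ge0 (R : realType) (a : nat) :
  0 <= (a%:R - 1) * (a%:R - 2) :> R.
Proof.
case: a => [|[|a]]; [by rewrite !sub0r mulrNN mul1r ler0n | by rewrite subrr mul0r |].
by rewrite -addn2 natrD mulr_ge0 // ?addrK ?ler0n // -addrA addr_ge0 ?ler0n //; lra.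
Qed.

Lemma class_weight_copy_ge0 (R : realType) (q : nat) (G : sgraph)
    (A K : {set G}) : (0 < q)%N -> Kq_copy q K ->
  0 <= \sum_(x in K) \sum_(y in K | y != x) class_weight R q A x y.
Proof.
move=> q_gt0 /andP[/eqP szK _]; pose a := #|A :&: K|.
have row x : x \in K -> \sum_(y in K | y != x) class_weight R q A x y =
    (q%:R * (q%:R - 1) * (a%:R - 3)) * (x \in A)%:R + 2 * (q%:R - 1).
  move=> xK; rewrite sum_class_weight_row.
  have -> : #|[set y | (y \in K) && (y != x)]|%:R = q%:R - 1 :> R.
    rewrite -szK (cardsD1 x K) xK natrD addrC addKr; congr (_%:R).
    by apply: eq_card => y; rewrite !inE andbC.
  have -> : #|[set y in A | (y \in K) && (y != x)]|%:R
      = a%:R - (x \in A)%:R :> R.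
    rewrite /a (cardsD1 x (A :&: K)) in_setI xK andbT natrD addrC addKr.
    by congr (_%:R); apply: eq_card => y; rewrite !inE andbA andbC.
  by case: (x \in A) => /=; ring.
rewrite (eq_bigr _ row) big_split /= -mulr_sumr sum_mem sumr_const szK.
have -> : [set x in A | x \in K] = A :&: K by apply/setP=> x; rewrite !inE.
rewrite -/a -[X in _ + X]mulr_natr.
have -> : q%:R * (q%:R - 1) * (a%:R - 3) * a%:R + 2 * (q%:R - 1) * q%:R
    = q%:R * (q%:R - 1) * ((a%:R - 1) * (a%:R - 2)) :> R by ring.
rewrite mulr_ge0 ?consecutive_product_ge0 // mulr_ge0 ?ler0n //.
by rewrite subr_ge0 ler1n.
Qed.

(** * The two-class graph, its degrees and its total weight *)

Lemma card_sum_mod_ge (s D : nat) (x : 'I_s) :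
  (D <= s)%N -> #|[set y : 'I_s | (D <= (x + y) %% s)%N]| = (s - D)%N.
Proof.
case: s x => [[] //|s] x Ds.
have -> : [set y : 'I_s.+1 | (D <= (x + y) %% s.+1)%N] =
    (fun y => x + y) @^-1: [set z : 'I_s.+1 | (D <= z)%N].
  by apply/setP=> y; rewrite !inE.
(* Translation by [x] permutes the residues, so the count does not depend on [x]. *)
rewrite on_card_preimset; last first.
  by apply: onW_bij; exists (fun y => y - x) => y; rewrite ?(addrC x) ?addrK ?subrK.
rewrite -sum1dep_card -(big_geq_mkord D s.+1 xpredT (fun=> 1%N)).
by rewrite sum_nat_const_nat muln1.
Qed.

Section TwoClassGraph.

Variables (q s t D : nat).

(* Testing the sum [x + y], not the difference, makes the relation symmetric. *)
Definition class_rel (u v : 'I_s + 'I_t) : bool :=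
  match u, v with
  | inl x, inl y => D <= (x + y) %% s
  | inr x, inr y => D <= (x + y) %% t
  | _, _ => true
  end%N.

Definition two_class_rel : rel (('I_s + 'I_t) * 'I_q)%type :=
  fun a b => (a.2 != b.2) && class_rel a.1 b.1.

Lemma two_class_sym : symmetric two_class_rel.
Proof.
move=> [u i] [v j]; rewrite /two_class_rel /= eq_sym; congr (_ && _).
by case: u v => [x|x] [y|y] //=; rewrite addnC.
Qed.

Lemma two_class_irr : irreflexive two_class_rel.
Proof. by move=> [u i]; rewrite /two_class_rel /= eqxx. Qed.

Definition two_class_graph : sgraph := SGraph two_class_sym two_class_irr.

Definition two_class_part (j : 'I_q) : {set two_class_graph} :=
  [set p : ('I_s + 'I_t) * 'I_q | p.2 == j].

Definition left_class : {set two_class_graph} :=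
  [set p : ('I_s + 'I_t) * 'I_q | is_inl p.1].

Hypotheses (Ds : (D <= s)%N) (Dt : (D <= t)%N).

Lemma card_two_class_graph : #|two_class_graph| = ((s + t) * q)%N.
Proof. by rewrite card_prod card_sum !card_ord. Qed.

Lemma card_sum_set (P : pred ('I_s + 'I_t)) :
  #|[set v | P v]| = (#|[set x | P (inl x)]| + #|[set y | P (inr y)]|)%N.
Proof.
by rewrite -!sum1dep_card big_sumType.
Qed.

Lemma card_class_rel (u : 'I_s + 'I_t) :
  #|[set v | class_rel u v]| = (s + t - D)%N.
Proof.
have full n : #|[set _ : 'I_n | true]| = n.
  by rewrite -[RHS]card_ord -cardsT; apply: eq_card => z; rewrite !inE.
by rewrite card_sum_set; case: u => x /=; rewrite full card_sum_mod_ge //; lia.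
Qed.

Lemma card_class_rel_left (u : 'I_s + 'I_t) :
  #|[set v | is_inl v && class_rel u v]| = if is_inl u then (s - D)%N else s.
Proof.
rewrite card_sum_set /= [X in (_ + X)%N]eq_card0 ?addn0; last by move=> z; rewrite inE.
case: u => x /=; first by rewrite card_sum_mod_ge.
by rewrite -[RHS]card_ord -cardsT; apply: eq_card => z; rewrite !inE.
Qed.

(** In each other part a vertex misses [D] vertices of its own class and none of the other class.
    The value is the same for both classes and all parts, which yields both divisibility and the
    minimum degree. *)
Lemma deg_two_class (x : two_class_graph) (j : 'I_q) :
  x \notin two_class_part j -> deg x (two_class_part j) = (s + t - D)%N.
Proof.
rewrite inE -(card_class_rel x.1) => xj.
rewrite -(card_imset _ (f := fun v => (v, j))) => [|u v [] //].
apply: eq_card => -[v k]; rewrite !inE /adj /= /two_class_rel /=.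
apply/andP/imsetP => [[/eqP -> /andP[_ uv]]|[w]].
  by exists v; rewrite ?inE.
by rewrite inE => uw [-> ->]; rewrite eqxx xj.
Qed.

Lemma two_class_q_partition : q_partition two_class_part.
Proof.
split=> [|i j ij|j x y].
- by apply/setP=> x; rewrite inE; apply/bigcupP; exists x.2; rewrite ?inE.
- rewrite -setI_eq0; apply/eqP/setP=> x; rewrite !inE.
  by apply: contraNF ij => /andP[/eqP <- /eqP <-].
- by rewrite !inE /adj /= /two_class_rel => /eqP -> /eqP ->; rewrite eqxx.
Qed.

Lemma two_class_balanced : balanced two_class_part.
Proof.
suff card_part j : #|two_class_part j| = (s + t)%N.
  by move=> i j; rewrite !card_part.
transitivity #|[set: 'I_s + 'I_t]|; last by rewrite cardsT card_sum !card_ord.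
rewrite -(card_imset _ (f := fun v : 'I_s + 'I_t => (v, j))) => [|u v [] //].
apply: eq_card => -[v k]; rewrite !inE /=.
by apply/eqP/imsetP => [->|[w _ [_ ->]]] //; exists v; rewrite ?inE.
Qed.

Lemma two_class_divisible : partite_divisible two_class_part.
Proof.
move=> i j x _; rewrite in_setU negb_or => /andP[xi xj].
by rewrite !deg_two_class.
Qed.

Lemma two_class_min_degree : (0 < q)%N ->
  (s + t - D <= partite_min_degree two_class_part)%N.
Proof.
move=> q_gt0; rewrite /partite_min_degree.
apply: (big_ind (fun m => s + t - D <= m)%N) => [|m n|[j x] /= xj].
(* The default value [#|G|] of the minimum must satisfy the bound too. *)
- by rewrite card_two_class_graph; nia.
- by rewrite leq_min => -> ->.
- by rewrite deg_two_class.
Qed.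

(** Adjacency is a condition on the class elements and an independent one on the part indices, so
    the neighbours counted form a product set. *)
Lemma card_two_class_adj (P : pred ('I_s + 'I_t)) (x : two_class_graph) :
  #|[set y in [set y : two_class_graph | P y.1] | adj x y]| =
  (#|[set v | P v && class_rel x.1 v]| * q.-1)%N.
Proof.
have -> : q.-1 = #|[set~ x.2]| by rewrite cardsC1 card_ord.
rewrite -cardsX; apply: eq_card => -[v k].
by rewrite !inE /adj /= /two_class_rel /= [x.2 == k]eq_sym [X in _ && X]andbC andbA.
Qed.

Lemma two_class_total (R : realType) : (0 < q)%N ->
  \sum_x \sum_(y | adj x y) class_weight R q left_class x y =
  q%:R * (q%:R - 1) * (q%:R * (q%:R - 1) * s%:R * (s%:R - D%:R)
     - 2 * q%:R * s%:R * (s%:R + t%:R - D%:R)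
     + 2 * (s%:R + t%:R) * (s%:R + t%:R - D%:R)).
Proof.
move=> q_gt0; have q1 : q.-1%:R = q%:R - 1 :> R by rewrite -subn1 natrB.
have std : (s + t - D)%:R = s%:R + t%:R - D%:R :> R by rewrite natrB ?natrD //; lia.
have row (x : two_class_graph) :
    \sum_(y | adj x y) class_weight R q left_class x y =
    (q%:R - 1) * (q%:R * (q%:R - 1) * (s%:R - D%:R)
      - 2 * q%:R * (s%:R + t%:R - D%:R)) * (x \in left_class)%:R
    + (q%:R - 1) * 2 * (s%:R + t%:R - D%:R).
  rewrite sum_class_weight_row.
  rewrite (card_two_class_adj (fun v => is_inl v)) card_class_rel_left.
  have -> : [set y | adj x y] =
      [set y in [set y : two_class_graph | predT y.1] | adj x y].
    by apply/setP=> y; rewrite !inE.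
  rewrite card_two_class_adj /= card_class_rel !natrM q1 std inE.
  by case: (is_inl x.1); rewrite ?natrB //=; ring.
rewrite (eq_bigr _ (fun x _ => row x)) big_split /= -mulr_sumr sum_mem sumr_const.
have -> : #|[set x in left_class | predT x]| = (s * q)%N.
  have -> : (s * q)%N = #|setX [set v : 'I_s + 'I_t | is_inl v] [set: 'I_q]|.
    rewrite cardsX card_sum_set cardsT card_ord /=.
    rewrite [X in (_ + X)%N]eq_card0 ?addn0; last by move=> z; rewrite inE.
    by rewrite -[in LHS](card_ord s) -cardsT; congr (_ * _)%N; apply: eq_card => z; rewrite !inE.
  by apply: eq_card => -[v k]; rewrite !inE /= !andbT.
rewrite -[X in _ + X]mulr_natr.
by have := card_two_class_graph; rewrite -[_ *+ _]mulr_natr => ->; rewrite !natrM natrD; ring.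
Qed.

End TwoClassGraph.

(** * Negative total weight and the choice of parameters *)

Lemma two_class_no_fractional (R : realType) (q s t D : nat) :
  (1 < q)%N -> (D <= s)%N -> (D <= t)%N ->
  q%:R * (q%:R - 1) * s%:R * (s%:R - D%:R)
    - 2 * q%:R * s%:R * (s%:R + t%:R - D%:R)
    + 2 * (s%:R + t%:R) * (s%:R + t%:R - D%:R) < 0 :> R ->
  ~ has_fractional_Kq_decomposition R q (two_class_graph q s t D).
Proof.
move=> q_gt1 Ds Dt neg frac; have q_gt0 := ltnW q_gt1.
have := fractional_dual frac (fun K cK => class_weight_copy_ge0 R (left_class q s t D) q_gt0 cK).
rewrite two_class_total // leNgt => /negP; apply.
by rewrite pmulr_rlt0 // mulr_gt0 ?subr_gt0 ?ltr1n ?ltr0n.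
Qed.

Theorem theorem1p7 (R : realType) (q : nat) (hq : (4 <= q)%N) :
  exists2 c : R, 1 < c &
    infinitely_many_graphs (fun G : sgraph =>
      (exists V : 'I_q -> {set G},
         [/\ q_partition V, balanced V, partite_divisible V &
             (1 - 1 / (c * (q%:R + 1))) * (#|G|%:R / q%:R)
               <= (partite_min_degree V)%:R])
      /\ ~ has_Kq_decomposition q G
      /\ ~ has_fractional_Kq_decomposition R q G).
Proof.
(* Substituting [k + 4] for [q] turns [4 <= q] into sign conditions on polynomials in [k >= 0]. *)
have [k qE] : exists k, q = (k + 4)%N by exists (q - 4)%N; lia.
(* With L = 3q these are s0 = (3q-1)L, s0 + t0 = 2(q^2-1)L and
   D0 = 2(q-1)L - 1, just below (s0 + t0)/(q+1). *)
pose s0 := ((3 * k + 11) * (3 * (k + 4)))%N.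
pose t0 := ((2 * k ^ 2 + 13 * k + 19) * (3 * (k + 4)))%N.
pose D0 := (6 * k ^ 2 + 42 * k + 71)%N.
have Ds : (D0 <= s0)%N by rewrite /D0 /s0; nia.
have Dt : (D0 <= t0)%N by rewrite /D0 /t0; nia.
have D0_gt0 : (0 < D0)%N by rewrite /D0; lia.
have D0_lt : ((q + 1) * D0 < s0 + t0)%N by rewrite qE /D0 /s0 /t0; nia.
have q1D_gt0 : 0 < (q%:R + 1) * D0%:R :> R.
  by rewrite mulr_gt0 ?ltr0n // natr1 ltr0n.
(* This [c] solves (s0 + t0) / (c (q + 1)) = D0, so the degree bound will hold with equality;
   [c > 1] is [D0_lt]. *)
exists ((s0 + t0)%:R / ((q%:R + 1) * D0%:R)).
  by rewrite ltr_pdivlMr // mul1r natr1 -natrM ltr_nat; move: D0_lt; rewrite addn1.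
(* Scaling all three parameters keeps [c] and multiplies the quadratic form by a square; the graphs
   differ in their number of vertices. *)
exists (fun m => two_class_graph q (m.+1 * s0) (m.+1 * t0) (m.+1 * D0)).
split=> [m|m n mn [f /bij_eq_card]]; last first.
  rewrite !card_two_class_graph => /eqP.
  by rewrite eqn_pmul2r -?mulnDr ?eqn_pmul2r ?eqSS; [move/eqP | lia..].
have Dms : (m.+1 * D0 <= m.+1 * s0)%N by rewrite leq_mul2l Ds orbT.
have Dmt : (m.+1 * D0 <= m.+1 * t0)%N by rewrite leq_mul2l Dt orbT.
have no_frac : ~ has_fractional_Kq_decomposition R q
    (two_class_graph q (m.+1 * s0) (m.+1 * t0) (m.+1 * D0)).
  apply: two_class_no_fractional => //; first by lia.
  rewrite qE /s0 /t0 /D0 !(natrM, natrD, natrX).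
  have : 0 <= k%:R :> R by rewrite ler0n.
  have : 0 < m.+1%:R :> R by rewrite ltr0n.
  move: (k%:R : R) (m.+1%:R : R) => x M M_gt0 x_ge0.
  (* For M = 1, D = 2(q-1)L would give -q(q-1)(q-3)^2 L^2, and lowering D by 1 adds L((3q-1)q(q-3) +
     4(q^2-1)). At L = 3q the first term dominates; this is the sum, factored with q = x + 4. The
     cubic is q(q-3)^2 - (q-1). *)
  have neg : forall y : R, y = - (M ^+ 2 * (3 * (x + 4) * (3 * (x + 4) * (x + 3) *
      (x ^+ 3 + 6 * x ^+ 2 + 8 * x + 1) + 4))) -> y < 0.
    move=> y ->; rewrite oppr_lt0.
    have cubic_ge0 : 0 <= x ^+ 3 + 6 * x ^+ 2 + 8 * x + 1.
      by rewrite !addr_ge0 ?mulr_ge0 ?exprn_ge0.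
    rewrite mulr_gt0 ?exprn_gt0 // mulr_gt0 //; first by lra.
    by rewrite ltr_wpDl // mulr_ge0 // !mulr_ge0 ?addr_ge0.
  by apply: neg; ring.
split; last by split=> // /(fractional_of_decomposition R (ltac:(lia) : (1 < q)%N)).
exists (two_class_part (m.+1 * s0) (m.+1 * t0) (m.+1 * D0)); split.
- exact: two_class_q_partition.
- exact: two_class_balanced.
- exact: two_class_divisible.
have q_gt0 : (0 < q)%N by lia.
have := two_class_min_degree Dms Dmt q_gt0.
rewrite -(ler_nat R); apply: le_trans; rewrite card_two_class_graph.
rewrite -mulnDr -mulnBr natrM mulfK ?pnatr_eq0 -?lt0n // !natrM natrB; last by lia.
have n_neq0 : (s0 + t0)%:R != 0 :> R by rewrite pnatr_eq0; lia.
have D_neq0 : D0%:R != 0 :> R by rewrite pnatr_eq0; lia.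
have q1_neq0 : q%:R + 1 != 0 :> R by rewrite natr1 pnatr_eq0.
rewrite le_eqVlt; apply/orP; left; apply/eqP; field.
by rewrite D_neq0 q1_neq0 -natrD n_neq0.
Qed.
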